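(* Let $B=B_0\oplus B_1$ be a Bol superalgebra with Killing-Ricci form $\beta$. For $x,y\in B_0\cup B_1$ let $R_{x,y}$ be the endomorphism of the vector superspace $B$ defined by $R_{x,y}(z)=(-1)^{\bar z(\bar x+\bar y)}[z,x,y]$ for all $z\in B_0\cup B_1$. Then for every $x,y\in B_0\cup B_1$, $$\beta(x,y)=\mathrm{str}\big(R_{x,y}+(-1)^{\bar x\bar y}R_{y,x}\big).$$
   Context: All vector superspaces and superalgebras are finite dimensional over a fixed field $\mathbb{K}$ of characteristic $0$; $\bar x\in\mathbb{Z}_2$ denotes the parity of a homogeneous element $x$. A Bol superalgebra is a superspace $B=B_0\oplus B_1$ with a bilinear operation $(x,y)\mapsto x\cdot y=xy$, $B_i\cdot B_j\subseteq B_{i+j}$, and a trilinear operation $[\,,\,,\,]$, $[B_i,B_j,B_k]\subseteq B_{i+j+k}$, such that for all homogeneous $x,y,z,u,v,w$: (BS1) $x\cdot y=-(-1)^{\bar x\bar y}y\cdot x$; (BS2) $[x,y,z]=-(-1)^{\bar x\bar y}[y,x,z]$; (BS3) $[x,y,z]+(-1)^{\bar x(\bar y+\bar z)}[y,z,x]+(-1)^{\bar z(\bar x+\bar y)}[z,x,y]=0$; (BS4) $[x,y,[u,v,w]]=[[x,y,u],v,w]+(-1)^{\bar u(\bar x+\bar y)}[u,[x,y,v],w]+(-1)^{(\bar x+\bar y)(\bar u+\bar v)}[u,v,[x,y,w]]$; (BS5) $[x,y,u\cdot v]=(-1)^{\bar u(\bar x+\bar y)}u\cdot[x,y,v]+[x,y,u]\cdot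 v+(-1)^{(\bar x+\bar y)(\bar u+\bar v)}[u,v,x\cdot y]+(x\cdot y)\cdot(u\cdot v)$. A linear map $P:B\to B$ of degree $r\in\mathbb{Z}_2$ is a pseudo superderivation with companion $a\in B_r$ if for all homogeneous $x,y,z$: $P([x,y,z])=[P(x),y,z]+(-1)^{r\bar x}[x,P(y),z]+(-1)^{r(\bar x+\bar y)}[x,y,P(z)]$ and $P(xy)=(-1)^{r\bar x}xP(y)+P(x)y+(-1)^{r(\bar x+\bar y)}[x,y,a]+a\cdot xy$. $\mathrm{Com}(P)$ is the set of companions of $P$. For homogeneous $x,y$, $D_{x,y}(z)=[x,y,z]$ is a pseudo superderivation of degree $\bar x+\bar y$ with companion $xy$. Let $ipS_r(B,B)$ be the span of all $D_{x,y}$ with $x,y$ homogeneous, $\bar x+\bar y=r$; let $IPS_r(B,B)=\{(P,c):P\in ipS_r(B,B),\ c\in\mathrm{Com}(P)\}$ and $IPS(B,B)=IPS_0(B,B)\oplus IPS_1(B,B)$. The standard enveloping Lie superalgebra of $B$ is $L(B)=B\oplus IPS(B,B)$, graded by $L(B)_i=B_i\oplus IPS_i(B,B)$, with bracket (bilinear), for homogeneous $x,y\in B$ and $(P,a)\in IPS_r(B,B)$, $(Q,b)\in IPS_s(B,B)$: $[x,y]=(D_{x,y},xy)$; $[(P,a),x]=-(-1)^{r\bar x}[x,(P,a)]=P(x)$; $[(P,a),(Q,b)]=(PQ-(-1)^{rs}QP,\ P(b)-(-1)^{rs}Q(a)-ab)$. It is a Lie superalgebra. Its Killing form is $\alpha(u,v)=\mathrm{str}(\mathrm{ad}\,u\circ\mathrm{ad}\,v)$,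 where $\mathrm{str}$ is the supertrace (trace on the even part minus trace on the odd part of the diagonal blocks). The Killing-Ricci form $\beta$ of $B$ is the restriction of $\alpha$ to $B\times B$. *)

(* Defs.v *)
From HB Require Import structures.
From mathcomp Require Import all_boot all_order all_algebra.
From mathcomp Require boolp.
From mathcomp Require Import ring.

Set Implicit Arguments.
Unset Strict Implicit.
Unset Printing Implicit Defensive.

Import GRing.Theory.
Local Open Scope ring_scope.

(* Z_2 is represented by bool: false is the even degree, true the odd one,  *)
(* (+) is the sum and && the product.                                       *)

Section Subspaces.
Variables (K : fieldType) (V : vectType K).
Implicit Types (S : V -> Prop) (U : {vspace V}).

Definition subspace_pred S : Prop :=
  S 0 /\ forall k u v, S u -> S v -> S (k *: u + v).

Lemma subspace_pred_ex S : subspace_pred S ->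
  exists U, forall v, v \in U <-> S v.
Proof.
case=> S0 SD.
have [n] := ubnP (\dim {:V} - \dim (0%VS : {vspace V})).
have: forall v, v \in (0%VS : {vspace V}) -> S v.
  by move=> v; rewrite memv0 => /eqP ->.
elim: n (0%VS : {vspace V}) => // n IHn U subU ltn.
case: (boolp.pselect (forall v, S v -> v \in U)) => [supU | /boolp.existsNP[w]].
  by exists U => v; split; [apply: subU | apply: supU].
move=> /boolp.not_implyP[Sw /negP nUw].
have subUw: (U <= U + <[w]>)%VS by apply: addvSl.
have ltd: (\dim U < \dim (U + <[w]>))%N.
  rewrite ltn_neqAle dimvS // andbT; apply: contra nUw => eqd.
  have /eqP -> : U == (U + <[w]>)%VS by rewrite eqEdim subUw (eqP eqd) leqnn.
  by apply: (subvP (addvSr _ _)); apply: memv_line.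
apply: (IHn (U + <[w]>)%VS) => [v /memv_addP[u Uu [t /vlineP[k ->] ->]]|].
  by rewrite addrC; apply: SD => //; apply: subU.
have: (\dim (U + <[w]>) <= \dim {:V})%N by apply/dimvS/subvf.
move: ltn ltd; rewrite !ltnS => ltn ltd led; apply: leq_trans ltn.
by apply: ltn_sub2l => //; apply: leq_trans led.
Qed.

Definition vspace_of S (hS : subspace_pred S) : {vspace V} :=
  sval (boolp.cid (subspace_pred_ex hS)).

Lemma vspace_ofP S (hS : subspace_pred S) v : v \in vspace_of hS <-> S v.
Proof. exact: (svalP (boolp.cid (subspace_pred_ex hS)) v). Qed.

Definition in_span S (v : V) : Prop :=
  exists2 s : seq V, forall w, w \in s -> S w & v \in <<s>>%VS.

Lemma in_span_subspace S : subspace_pred (in_span S).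
Proof.
split=> [|k u v [s Ss us] [t St vt]]; first by exists [::]; rewrite ?mem0v.
exists (s ++ t) => [w|]; first by rewrite mem_cat => /orP[/Ss|/St].
rewrite span_cat; apply: memv_add => //; exact: memvZ.
Qed.

Lemma in_span_ind S T v :
  subspace_pred T -> (forall w, S w -> T w) -> in_span S v -> T v.
Proof.
move=> hT ST [s Ss vs]; apply/(vspace_ofP hT); move: v vs; apply/subvP/span_subvP.
by move=> w /Ss /ST /(vspace_ofP hT).
Qed.

Lemma mem_in_span S v : S v -> in_span S v.
Proof.
exists [:: v]; last by rewrite memv_span ?mem_head.
by move=> w; rewrite inE => /eqP ->.
Qed.

End Subspaces.

Lemma vect_scalarP (K : fieldType) (V : vectType K) (u v : V) :
  (forall phi : V -> K, {morph phi : x y / x + y} -> {morph phi : x / - x} ->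
    (forall k x, phi (k *: x) = k * phi x) -> phi u = phi v) -> u = v.
Proof.
move=> h; have uV := coord_vbasis (memvf u); have vV := coord_vbasis (memvf v).
rewrite uV vV; apply: eq_bigr => i _; congr (_ *: _).
by apply: (h (coord (vbasis {:V}) i)); [apply: linearD|apply: linearN|move=> k x; rewrite linearZ].
Qed.

(* Proves a linear identity between vectors by testing it on linear forms.  *)
Ltac expand_vect :=
  let phi := fresh "phi" in let D := fresh in let N := fresh in let Z := fresh in
  apply: vect_scalarP => phi D N Z; rewrite ?(D, N, Z);
  repeat match goal with |- context [phi ?x] => move: (phi x) => ? end;
  clear phi D N Z.

Record superspace (K : fieldType) := Superspace {
  carrier :> vectType K;
  part : bool -> {vspace carrier};
  part_full : (part false + part true = fullv)%VS;
  part_direct : (part false :&: part true = 0)%VS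
}.
Arguments part {K} s i.

Section Superspace.
Variables (K : fieldType) (V : superspace K).

Definition hproj (i : bool) : 'End(V) := daddv_pi (part V i) (part V (~~ i)).

Lemma mem_hproj i v : hproj i v \in part V i.
Proof. exact: memv_pi. Qed.

Lemma part_cap i : (part V i :&: part V (~~ i) = 0)%VS.
Proof. by case: i => /=; [rewrite capvC|]; apply: part_direct. Qed.

Lemma hproj_id i v : v \in part V i -> hproj i v = v.
Proof. by move=> hv; apply: daddv_pi_id hv; apply: part_cap. Qed.

Lemma hproj_sum v : hproj false v + hproj true v = v.
Proof. by apply: daddv_pi_add; rewrite ?part_direct ?part_full ?memvf. Qed.

Lemma hprojE i j v : v \in part V i -> hproj j v = (i == j)%:R *: v.
Proof.
move=> vi; have [<-|ne] := eqVneq; first by rewrite scale1r hproj_id.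
have := hproj_sum v; have := hproj_id vi.
case: i j ne {vi} => [] [] // _ ->; rewrite scale0r => hs.
  by apply: (addIr v); rewrite add0r.
by apply: (addrI v); rewrite addr0.
Qed.

Lemma part_ind (S : V -> Prop) :
  (forall u v, S u -> S v -> S (u + v)) ->
  (forall i v, v \in part V i -> S v) -> forall v, S v.
Proof. by move=> SD Sh v; rewrite -(hproj_sum v); apply: SD; apply: Sh (mem_hproj _ _). Qed.

(* Trace of the diagonal block V_i -> V_i of f.                             *)
Definition block_trace (i : bool) (f : 'End(V)) : K :=
  \tr (\matrix_(j < \dim (part V i), k < \dim (part V i))
         coord (vbasis (part V i)) k (hproj i (f (vbasis (part V i))`_j))).

Definition str (f : 'End(V)) : K := block_trace false f - block_trace true f.

Definition has_degree (r : bool) (f : 'End(V)) : Prop :=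
  forall i x, x \in part V i -> f x \in part V (r (+) i).

End Superspace.

Record bolSuperalgebra (K : fieldType) := BolSuperalgebra {
  bol_space :> superspace K;
  bmul : 'Hom(bol_space, 'Hom(bol_space, bol_space));
  btri : 'Hom(bol_space, 'Hom(bol_space, 'Hom(bol_space, bol_space)));
  bmul_part : forall i j x y,
    x \in part bol_space i -> y \in part bol_space j ->
    bmul x y \in part bol_space (i (+) j);
  btri_part : forall i j k x y z,
    x \in part bol_space i -> y \in part bol_space j ->
    z \in part bol_space k ->
    btri x y z \in part bol_space (i (+) j (+) k);
  bs1 : forall i j x y,
    x \in part bol_space i -> y \in part bol_space j ->
    bmul x y = - ((-1) ^+ (i && j) *: bmul y x);
  bs2 : forall i j k x y z,
    x \in part bol_space i -> y \in part bol_space j ->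
    z \in part bol_space k ->
    btri x y z = - ((-1) ^+ (i && j) *: btri y x z);
  bs3 : forall i j k x y z,
    x \in part bol_space i -> y \in part bol_space j ->
    z \in part bol_space k ->
    btri x y z + (-1) ^+ (i && (j (+) k)) *: btri y z x
      + (-1) ^+ (k && (i (+) j)) *: btri z x y = 0;
  bs4 : forall i j k l m x y u v w,
    x \in part bol_space i -> y \in part bol_space j ->
    u \in part bol_space k -> v \in part bol_space l ->
    w \in part bol_space m ->
    btri x y (btri u v w) =
      btri (btri x y u) v w
      + (-1) ^+ (k && (i (+) j)) *: btri u (btri x y v) w
      + (-1) ^+ ((i (+) j) && (k (+) l)) *: btri u v (btri x y w);
  bs5 : forall i j k l x y u v,
    x \in part bol_space i -> y \in part bol_space j ->
    u \in part bol_space k -> v \in part bol_space l ->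
    btri x y (bmul u v) =
      (-1) ^+ (k && (i (+) j)) *: bmul u (btri x y v)
      + bmul (btri x y u) v
      + (-1) ^+ ((i (+) j) && (k (+) l)) *: btri u v (bmul x y)
      + bmul (bmul x y) (bmul u v)
}.

Section Bol.
Variables (K : fieldType) (B : bolSuperalgebra K).
Implicit Types (x y z a b c : B) (P Q : 'End(B)) (i j k r s : bool).

Lemma bmulDl x y z : bmul B (x + y) z = bmul B x z + bmul B y z.
Proof. by rewrite linearD lfunE. Qed.
Lemma bmulDr x y z : bmul B x (y + z) = bmul B x y + bmul B x z.
Proof. by rewrite linearD. Qed.
Lemma bmulZl (k : K) x y : bmul B (k *: x) y = k *: bmul B x y.
Proof. by rewrite linearZ lfunE. Qed.
Lemma bmulZr (k : K) x y : bmul B x (k *: y) = k *: bmul B x y.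
Proof. by rewrite linearZ. Qed.
Lemma btriDl x x' y z : btri B (x + x') y z = btri B x y z + btri B x' y z.
Proof. by rewrite linearD !lfunE. Qed.
Lemma btriDm x y y' z : btri B x (y + y') z = btri B x y z + btri B x y' z.
Proof. by rewrite linearD lfunE. Qed.
Lemma btriDr x y z z' : btri B x y (z + z') = btri B x y z + btri B x y z'.
Proof. by rewrite linearD. Qed.
Lemma btriZl (k : K) x y z : btri B (k *: x) y z = k *: btri B x y z.
Proof. by rewrite linearZ !lfunE. Qed.
Lemma btriZm (k : K) x y z : btri B x (k *: y) z = k *: btri B x y z.
Proof. by rewrite linearZ lfunE. Qed.
Lemma btriZr (k : K) x y z : btri B x y (k *: z) = k *: btri B x y z.
Proof. by rewrite linearZ. Qed.
Lemma endD P x y : P (x + y) = P x + P y.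
Proof. exact: linearD. Qed.
Lemma endZ P (k : K) x : P (k *: x) = k *: P x.
Proof. exact: linearZ. Qed.
Definition lfun0E := (linear0, zero_lfunE, comp_lfun0l, comp_lfun0r, scaler0,
  oppr0, addr0, add0r).
Definition bolE := (bmulDl, bmulDr, bmulZl, bmulZr, btriDl, btriDm, btriDr,
  btriZl, btriZm, btriZr).

(* a is a companion of the pseudo superderivation P of degree r.            *)
Definition companion r P a : Prop :=
  [/\ has_degree r P,
      a \in part B r,
      forall i j k x y z,
        x \in part B i -> y \in part B j -> z \in part B k ->
        P (btri B x y z) =
          btri B (P x) y z + (-1) ^+ (r && i) *: btri B x (P y) z
          + (-1) ^+ (r && (i (+) j)) *: btri B x y (P z)
    & forall i j x y,
        x \in part B i -> y \in part B j ->
        P (bmul B x y) =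
          (-1) ^+ (r && i) *: bmul B x (P y) + bmul B (P x) y
          + (-1) ^+ (r && (i (+) j)) *: btri B x y a
          + bmul B a (bmul B x y)].

(* D_{x,y} is the partial application btri B x y.                           *)
Definition ipS r : 'End(B) -> Prop :=
  in_span (fun P => exists i j x y,
    [/\ x \in part B i, y \in part B j, i (+) j = r & P = btri B x y]).

Definition IPS_pred r (p : 'End(B) * B) : Prop :=
  ipS r p.1 /\ companion r p.1 p.2.

Lemma IPS_subspace r : subspace_pred (IPS_pred r).
Proof.
split=> [|k [P a] [Q b] [/= hP [Pd Pa PT PM]] [/= hQ [Qd Qa QT QM]]].
  split; first exact: (in_span_subspace _).1.
  split=> [i x _||i j k x y z _ _ _|i j x y _ _] /=; rewrite ?mem0v //;
    by rewrite !(zero_lfunE, linear0, scaler0, addr0) ?mem0v.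
split; first exact: (in_span_subspace _).2.
split=> [i x xi||i j l x y z xi yj zl|i j x y xi yj] /=.
- by rewrite add_lfunE scale_lfunE memvD ?memvZ ?Pd ?Qd.
- by rewrite memvD ?memvZ.
- rewrite !(add_lfunE, scale_lfunE) (PT _ _ _ _ _ _ xi yj zl) (QT _ _ _ _ _ _ xi yj zl).
  rewrite !bolE.
  by expand_vect; ring.
- rewrite !(add_lfunE, scale_lfunE) (PM _ _ _ _ xi yj) (QM _ _ _ _ xi yj) !bolE.
  by expand_vect; ring.
Qed.


Lemma partI i x : x \in part B i -> x \in part B (~~ i) -> x = 0.
Proof. by move=> xi xi'; apply/eqP; rewrite -memv0 -(part_cap B i) memv_cap xi. Qed.

Definition IPS_part r : {vspace 'End(B) * B} := vspace_of (IPS_subspace r).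

Lemma IPS_partP r P a : (P, a) \in IPS_part r <-> ipS r P /\ companion r P a.
Proof. exact: vspace_ofP. Qed.

Lemma IPS_direct : (IPS_part false :&: IPS_part true = 0)%VS.
Proof.
apply/eqP; rewrite -subv0; apply/subvP => -[P a].
rewrite memv_cap memv0 => /andP[/IPS_partP[_ [dP a0 _ _]] /IPS_partP[_ [dP' a1 _ _]]].
have -> : a = 0 by apply: partI a0 a1.
suff -> : P = 0 by [].
apply/lfunP; apply: part_ind => [u v hu hv|i v vi].
  by rewrite !linearD /= hu hv.
by rewrite zero_lfunE; apply: (@partI i); [apply: dP vi | apply: dP' vi].
Qed.

(* By IPS_direct, this internal sum is the direct sum IPS_0 (+) IPS_1.      *)
Definition IPS : {vspace 'End(B) * B} := (IPS_part false + IPS_part true)%VS.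

Lemma IPS_part_sub r : (IPS_part r <= IPS)%VS.
Proof. by case: r; [apply: addvSr | apply: addvSl]. Qed.

Definition L_pred r (u : B * subvs_of IPS) : Prop :=
  u.1 \in part B r /\ vsval u.2 \in IPS_part r.

Lemma L_pred_subspace r : subspace_pred (L_pred r).
Proof.
split=> [|k [x p] [y q] [/= xr pr] [/= yr qr]].
  by split=> /=; rewrite ?linear0 mem0v.
by split=> /=; rewrite ?linearP memvD ?memvZ.
Qed.

Definition L_part r : {vspace B * subvs_of IPS} := vspace_of (L_pred_subspace r).

Lemma L_partP r x (p : subvs_of IPS) :
  (x, p) \in L_part r <-> x \in part B r /\ vsval p \in IPS_part r.
Proof. exact: vspace_ofP. Qed.

Lemma L_part_full : (L_part false + L_part true = fullv)%VS.
Proof.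
apply/vspaceP => -[x p]; rewrite memvf.
have /memv_addP[P0 hP0 [P1 hP1 eP]] := subvsP p.
have sub r w : w \in IPS_part r -> vsval (vsproj IPS w) = w.
  by move=> hw; rewrite vsprojK //; apply: (subvP (IPS_part_sub r)).
have -> : (x, p) = (hproj B false x, vsproj IPS P0)
                 + (hproj B true x, vsproj IPS P1) :> B * subvs_of IPS.
  congr (_, _); first by rewrite hproj_sum.
  apply: val_inj => /=; rewrite [LHS]eP -[in LHS](sub _ _ hP0).
  by rewrite -[in LHS](sub _ _ hP1) -raddfD.
by apply: memv_add; apply/L_partP; rewrite mem_hproj (sub _ _ hP0, sub _ _ hP1).
Qed.

Lemma L_part_direct : (L_part false :&: L_part true = 0)%VS.
Proof.
apply/eqP; rewrite -subv0; apply/subvP => -[x p].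
rewrite memv_cap memv0 => /andP[/L_partP[x0 p0] /L_partP[x1 p1]].
rewrite (partI x0 x1); suff -> : p = 0 by [].
apply: val_inj; rewrite linear0; apply/eqP; rewrite -memv0 -IPS_direct.
by rewrite memv_cap p0.
Qed.

(* The superspace L(B) = B (+) IPS(B,B).                                    *)
Definition stdL : superspace K :=
  @Superspace K (B * subvs_of IPS)%type L_part L_part_full L_part_direct.

Lemma companion_btri i j x y : x \in part B i -> y \in part B j ->
  companion (i (+) j) (btri B x y) (bmul B x y).
Proof.
move=> xi yj; split=> [k z zk||k l m u v w uk vl wm|k l u v uk vl].
- exact: btri_part.
- exact: bmul_part.
- by rewrite (bs4 xi yj uk vl wm) andbC.
- by rewrite (bs5 xi yj uk vl) andbC.
Qed.

Lemma IPS_btri i j x y : x \in part B i -> y \in part B j ->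
  (btri B x y, bmul B x y) \in IPS_part (i (+) j).
Proof.
move=> xi yj; apply/IPS_partP; split; last exact: companion_btri.
by apply: mem_in_span; exists i, j, x, y.
Qed.

Lemma ipS_commutator r s P Q b : ipS r P -> companion s Q b ->
  ipS (r (+) s) ((P \o Q)%VF - (-1) ^+ (r && s) *: (Q \o P)%VF).
Proof.
move=> hP [dQ _ QT _].
pose T P' := ipS (r (+) s) ((P' \o Q)%VF - (-1) ^+ (r && s) *: (Q \o P')%VF).
apply: (@in_span_ind _ _ _ T) hP => [|_ [i [j [x [y [xi yj er ->]]]]]].
  rewrite /T; split; first by
    rewrite comp_lfun0l comp_lfun0r scaler0 subrr; apply: (in_span_subspace _).1.
  move=> k u v hu hv.
  have -> : ((k *: u + v) \o Q)%VF - (-1) ^+ (r && s) *: (Q \o (k *: u + v))%VF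
    = k *: ((u \o Q)%VF - (-1) ^+ (r && s) *: (Q \o u)%VF)
      + ((v \o Q)%VF - (-1) ^+ (r && s) *: (Q \o v)%VF).
    rewrite comp_lfunDl comp_lfunDr -comp_lfunZl -comp_lfunZr.
    by expand_vect; ring.
  exact: (in_span_subspace _).2.
rewrite /T -er.
have -> : (btri B x y \o Q)%VF - (-1) ^+ ((i (+) j) && s) *: (Q \o btri B x y)%VF
  = (- (-1) ^+ ((i (+) j) && s)) *: btri B (Q x) y
    + (- ((-1) ^+ ((i (+) j) && s) * (-1) ^+ (s && i))) *: btri B x (Q y).
  apply/lfunP; apply: part_ind => [u v hu hv|k z zk].
    by rewrite !linearD /= hu hv.
  rewrite !(add_lfunE, opp_lfunE, scale_lfunE, comp_lfunE) (QT _ _ _ _ _ _ xi yj zk).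
  expand_vect.
  by case: (i); case: (j); case: (s) => /=; ring.
apply: (in_span_subspace _).2; last rewrite -[_ *: _]addr0.
  by apply: mem_in_span; exists (s (+) i), j, (Q x), y; split=> //;
    [apply: dQ | rewrite -addbA addbC].
apply: (in_span_subspace _).2; last exact: (in_span_subspace _).1.
by apply: mem_in_span; exists i, (s (+) j), x, (Q y); split=> //;
  [apply: dQ | rewrite [s (+) j]addbC addbA].
Qed.

Lemma companion_commutator r s P Q a b : companion r P a -> companion s Q b ->
  companion (r (+) s) ((P \o Q)%VF - (-1) ^+ (r && s) *: (Q \o P)%VF)
    (P b - (-1) ^+ (r && s) *: Q a - bmul B a b).
Proof.
move=> [dP ar PT PM] [dQ bs QT QM].
have pb := dP _ _ bs; have qa : Q a \in part B (r (+) s) by rewrite addbC dQ.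
have ab := bmul_part ar bs.
split=> [i x xi||i j k x y z xi yj zk|i j x y xi yj].
- rewrite !(add_lfunE, opp_lfunE, scale_lfunE, comp_lfunE) -addbA.
  rewrite memvB ?memvZ //; first by rewrite dP ?dQ.
  by rewrite addbCA dQ ?dP.
- by rewrite !memvB ?memvZ.
- have Px := dP _ _ xi; have Py := dP _ _ yj; have Pz := dP _ _ zk.
  have Qx := dQ _ _ xi; have Qy := dQ _ _ yj; have Qz := dQ _ _ zk.
  rewrite !(add_lfunE, opp_lfunE, scale_lfunE, comp_lfunE).
  rewrite (PT _ _ _ _ _ _ xi yj zk) (QT _ _ _ _ _ _ xi yj zk).
  rewrite !(endD, endZ).
  rewrite (PT _ _ _ _ _ _ Qx yj zk) (QT _ _ _ _ _ _ Px yj zk).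
  rewrite (PT _ _ _ _ _ _ xi Qy zk) (QT _ _ _ _ _ _ xi Py zk).
  rewrite (PT _ _ _ _ _ _ xi yj Qz) (QT _ _ _ _ _ _ xi yj Pz).
  rewrite -!scaleNr !bolE.
  expand_vect.
  by case: (r); case: (s); case: (i); case: (j) => /=; ring.
have xy := bmul_part xi yj.
have E5 := bs5 xi yj ar bs.
have E1 := bs1 (btri_part xi yj ar) bs.
have E1' := bs1 xy ab.
have /eqP := bs3 ar bs xy; rewrite -addrA addr_eq0 => /eqP E3.
have E2 := bs2 xy ar bs.
have Qx := dQ _ _ xi; have Qy := dQ _ _ yj.
have Px := dP _ _ xi; have Py := dP _ _ yj.
rewrite !(add_lfunE, opp_lfunE, scale_lfunE, comp_lfunE).
rewrite (PM _ _ _ _ xi yj) (QM _ _ _ _ xi yj).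
rewrite !(endD, endZ).
rewrite (PM _ _ _ _ Qx yj) (QM _ _ _ _ Px yj).
rewrite (PM _ _ _ _ xi Qy) (QM _ _ _ _ xi Py).
rewrite (PT _ _ _ _ _ _ xi yj bs) (QT _ _ _ _ _ _ xi yj ar).
rewrite (PM _ _ _ _ bs xy) (QM _ _ _ _ ar xy).
rewrite (PM _ _ _ _ xi yj) (QM _ _ _ _ xi yj).
rewrite -!scaleNr -!scaleN1r !bolE E5 E1 E1' E3 E2.
expand_vect.
by case: (r); case: (s); case: (i); case: (j) => /=; ring.
Qed.

Lemma IPS_commutator r s P Q a b :
  (P, a) \in IPS_part r -> (Q, b) \in IPS_part s ->
  ((P \o Q)%VF - (-1) ^+ (r && s) *: (Q \o P)%VF,
   P b - (-1) ^+ (r && s) *: Q a - bmul B a b) \in IPS_part (r (+) s).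
Proof.
move=> /IPS_partP[hP cP] /IPS_partP[hQ cQ]; apply/IPS_partP; split.
  exact: ipS_commutator hP cQ.
exact: companion_commutator.
Qed.

(* All cases of the bracket of L_r with L_s at once, for u = x + (P, a) and *)
(* v = y + (Q, b). By IPS_btri and IPS_commutator, for such u and v the     *)
(* argument of vsproj already lies in IPS. See bracket_BB, bracket_IB,      *)
(* bracket_BI and bracket_II for the individual formulas.                   *)
Definition hbracket r s (u v : stdL) : stdL :=
  let x := u.1 in let P := (vsval u.2).1 in let a := (vsval u.2).2 in
  let y := v.1 in let Q := (vsval v.2).1 in let b := (vsval v.2).2 in
  (P y - (-1) ^+ (r && s) *: Q x,
   vsproj IPS
     (btri B x y + ((P \o Q)%VF - (-1) ^+ (r && s) *: (Q \o P)%VF),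
      bmul B x y + (P b - (-1) ^+ (r && s) *: Q a - bmul B a b))).

Lemma hbracket_linear r s u : linear (hbracket r s u).
Proof.
case: u => x p k [y q] [y' q'].
congr (_, _) => /=.
  rewrite add_lfunE scale_lfunE endD endZ.
  by expand_vect; ring.
apply: etrans (linearP (vsproj IPS) k _ _); congr (vsproj _ _); congr (_, _) => /=.
  rewrite linearP /= comp_lfunDl comp_lfunDr -comp_lfunZl -comp_lfunZr.
  by expand_vect; ring.
rewrite add_lfunE scale_lfunE !(bolE, endD, endZ).
by expand_vect; ring.
Qed.

Lemma hbracket0l r s v : hbracket r s 0 v = 0.
Proof.
case: v => y q; congr (_, _) => /=.
  by rewrite !lfun0E.
rewrite -[RHS](linear0 (vsproj IPS)); congr (vsproj _ _); congr (_, _) => /=.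
  by rewrite !lfun0E.
by rewrite !lfun0E.
Qed.

(* Bilinear extension of the bracket of homogeneous elements.               *)
Definition bracket (u v : stdL) : stdL :=
  \sum_(r : bool) \sum_(s : bool)
    hbracket r s (hproj stdL r u) (hproj stdL s v).

Lemma bracket_linear u : linear (bracket u).
Proof.
move=> k v w; rewrite /bracket scaler_sumr -big_split; apply: eq_bigr => r _.
rewrite scaler_sumr -big_split; apply: eq_bigr => s _ /=.
by rewrite linearP hbracket_linear.
Qed.

HB.instance Definition _ u :=
  GRing.isLinear.Build K stdL stdL _ (bracket u) (bracket_linear u).

Lemma bracketE r s u v : u \in part stdL r -> v \in part stdL s ->
  bracket u v = hbracket r s u v.
Proof.
move=> ur vs; have h0r r' s' u' : hbracket r' s' u' 0 = 0.
  have := hbracket_linear r' s' u' (-1) 0 0.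
  by rewrite scaler0 addr0 scaleN1r addNr.
rewrite /bracket !big_bool !(hprojE _ ur) !(hprojE _ vs).
move: h0r hbracket0l {ur vs}; move: hbracket => h h0r h0l.
by case: r s => [] [] /=; rewrite !(scale1r, scale0r, h0l, h0r, addr0, add0r).
Qed.

Definition inB x : stdL := (x, 0).
Definition inIPS (p : 'End(B) * B) : stdL := (0, vsproj IPS p).

Lemma inB_part i x : x \in part B i -> inB x \in part stdL i.
Proof. by move=> xi; apply/L_partP; rewrite linear0 mem0v. Qed.

Lemma inIPSK r p : p \in IPS_part r -> vsval (inIPS p).2 = p.
Proof. by move=> hp; rewrite /= vsprojK //; apply: (subvP (IPS_part_sub r)). Qed.

Lemma inIPS_part r p : p \in IPS_part r -> inIPS p \in part stdL r.
Proof. by move=> hp; apply/L_partP; rewrite mem0v (inIPSK hp). Qed.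

Lemma bracket_BB i j x y : x \in part B i -> y \in part B j ->
  bracket (inB x) (inB y) = inIPS (btri B x y, bmul B x y).
Proof.
move=> xi yj; rewrite (bracketE (inB_part xi) (inB_part yj)).
congr (_, _) => /=; first by rewrite !lfun0E.
congr (vsproj _ _); congr (_, _) => /=.
  by rewrite comp_lfun0l scaler0 ?subrr ?addr0.
by rewrite !lfun0E.
Qed.

Lemma bracket_IB r i P a x : (P, a) \in IPS_part r -> x \in part B i ->
  bracket (inIPS (P, a)) (inB x) = inB (P x).
Proof.
move=> Pr xi; rewrite (bracketE (inIPS_part Pr) (inB_part xi)).
rewrite /hbracket (inIPSK Pr) /=; congr (_, _).
  by rewrite !lfun0E.
rewrite -[RHS](linear0 (vsproj IPS)); congr (vsproj _ _); congr (_, _) => /=.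
  by rewrite !lfun0E.
by rewrite !lfun0E.
Qed.

Lemma bracket_BI r i P a x : (P, a) \in IPS_part r -> x \in part B i ->
  bracket (inB x) (inIPS (P, a)) = inB (- ((-1) ^+ (r && i) *: P x)).
Proof.
move=> Pr xi; rewrite (bracketE (inB_part xi) (inIPS_part Pr)).
rewrite /hbracket (inIPSK Pr) /= andbC; congr (_, _).
  by rewrite !lfun0E.
rewrite -[RHS](linear0 (vsproj IPS)); congr (vsproj _ _); congr (_, _) => /=.
  by rewrite !lfun0E.
by rewrite !lfun0E.
Qed.

Lemma bracket_II r s P Q a b :
  (P, a) \in IPS_part r -> (Q, b) \in IPS_part s ->
  bracket (inIPS (P, a)) (inIPS (Q, b)) =
  inIPS ((P \o Q)%VF - (-1) ^+ (r && s) *: (Q \o P)%VF,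
         P b - (-1) ^+ (r && s) *: Q a - bmul B a b).
Proof.
move=> Pr Qs; rewrite (bracketE (inIPS_part Pr) (inIPS_part Qs)).
rewrite /hbracket (inIPSK Pr) (inIPSK Qs) /=; congr (_, _).
  by rewrite !lfun0E.
by rewrite !lfun0E.
Qed.

Definition ad (u : stdL) : 'End(stdL) := linfun (bracket u).

Definition killing (u v : stdL) : K := str (ad u \o ad v)%VF.

Definition killing_ricci (x y : B) : K := killing (inB x) (inB y).

Definition ricci_fun x y z : B :=
  \sum_(i : bool) \sum_(j : bool) \sum_(k : bool)
    (-1) ^+ (k && (i (+) j)) *: btri B (hproj B k z) (hproj B i x) (hproj B j y).

Lemma ricci_fun_linear x y : linear (ricci_fun x y).
Proof.
move=> t v w; rewrite /ricci_fun scaler_sumr -big_split; apply: eq_bigr => i _.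
rewrite scaler_sumr -big_split; apply: eq_bigr => j _ /=.
rewrite scaler_sumr -big_split; apply: eq_bigr => k _ /=.
by rewrite linearP !bolE scalerDr !scalerA mulrC.
Qed.

HB.instance Definition _ x y :=
  GRing.isLinear.Build K B B _ (ricci_fun x y) (ricci_fun_linear x y).

(* R_{x,y}, extended bilinearly to all x and y, cf. ricci_endE.             *)
Definition ricci_end x y : 'End(B) := linfun (ricci_fun x y).

Lemma ricci_endE i j k x y z :
  x \in part B i -> y \in part B j -> z \in part B k ->
  ricci_end x y z = (-1) ^+ (k && (i (+) j)) *: btri B z x y.
Proof.
move=> xi yj zk; rewrite lfunE /= /ricci_fun.
rewrite !big_bool !(hprojE _ xi) !(hprojE _ yj) !(hprojE _ zk) !bolE.
by case: i j k {xi yj zk} => [] [] [] /=; rewrite !(scale1r, scale0r, scaler0, addr0, add0r).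
Qed.

End Bol.

(* Main.v *)
From HB Require Import structures.
Require Import Defs.
From mathcomp Require Import all_boot all_order all_algebra.
From mathcomp Require Import ring.

Set Implicit Arguments.
Unset Strict Implicit.
Unset Printing Implicit Defensive.

Import GRing.Theory VectorInternalTheory.
Local Open Scope ring_scope.

(** For a linear map f : W -> V between superspaces and a map g : V -> W of
    degree t, the supertrace satisfies str (f g) = (-1)^t str (g f) [strC].
    This is applied to the decomposition L(B) = B + IPS(B,B), with inclusion
    incB and projection prB of the first summand.

    Composing ad x o ad y with the two projections of L(B) splits its
    supertrace in two. Cyclicity, with g = prB, turns the part supported on B
    into the supertrace of the compression adB x y = prB (ad x) (ad y) incB to
    B. Since ad y maps IPS(B,B) into B and ad x maps B into IPS(B,B), the part
    supported on IPS(B,B) factors through B as f g, where g is the restriction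
    of ad y to IPS(B,B), of degree j, and f is the restriction of ad x to B;
    then g f = adB y x, so cyclicity gives (-1)^j str (adB y x)
    [killing_ricciE].

    The bracket formulas give adB x y (z) = [x, [y, z]] = +- [y, z, x], and the
    antisymmetry of the triple product in its first two arguments identifies
    adB x y with (-1)^(ij) R_{y,x} [adB_E]. Hence
    beta(x, y) = (-1)^(ij) str R_{y,x} + (-1)^(j + ij) str R_{x,y}.
    If i = j, the second sign is +1; otherwise R_{x,y} is odd and has zero
    supertrace [str_odd]. *)

(** * Basis-free trace of endomorphisms *)

Section Trace.
Variable K : fieldType.
Implicit Types U V W : vectType K.

(** The trace of f, read off its matrix in the built-in coordinates of V. *)
Definition lftrace V (f : 'End(V)) : K := \tr (f2mx f).

Lemma v2r_lfun V W (f : 'Hom(V, W)) v : v2r (f v) = v2r v *m f2mx f.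
Proof. by rewrite unlock /= r2vK. Qed.

Lemma f2mx_comp U V W (f : 'Hom(V, W)) (g : 'Hom(U, V)) :
  f2mx (f \o g)%VF = f2mx g *m f2mx f.
Proof.
apply/row_matrixP => i; rewrite !rowE -[delta_mx 0 i]r2vK mulmxA -!v2r_lfun.
by rewrite comp_lfunE.
Qed.

Lemma lftraceC V W (f : 'Hom(V, W)) (g : 'Hom(W, V)) :
  lftrace (f \o g)%VF = lftrace (g \o f)%VF.
Proof. by rewrite /lftrace !f2mx_comp mxtrace_mulC. Qed.

Lemma lftrace_linear V : scalar (@lftrace V).
Proof.
move=> k f g; rewrite /lftrace -mxtraceZ -mxtraceD; congr (\tr _).
apply/row_matrixP => i; rewrite [RHS]linearP /= !rowE.
by rewrite -[delta_mx 0 i]r2vK -!v2r_lfun add_lfunE scale_lfunE linearP.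
Qed.

HB.instance Definition _ V :=
  GRing.isLinear.Build K 'End(V) K _ (@lftrace V) (@lftrace_linear V).

(** The matrix on the left is that of the compression p f : U -> U in a basis
    of U. *)
Lemma lftrace_proj V (U : {vspace V}) (p f : 'End(V)) :
  (forall v, p v \in U) ->
  \tr (\matrix_(j < \dim U, k < \dim U) coord (vbasis U) k (p (f (vbasis U)`_j)))
  = lftrace (p \o f)%VF.
Proof.
move=> pU.
(* p factors through the coordinates on U: v maps to its coordinates by C,   *)
(* and coordinates map to the vector of U by E.                             *)
pose E := \matrix_(j < \dim U) v2r (vbasis U)`_j.
pose C := \matrix_(i < dim V, k < \dim U) coord (vbasis U) k (p (r2v (delta_mx 0 i))).
have rC v : \row_k coord (vbasis U) k (p v) = v2r v *m C.
  rewrite -[v in LHS]v2rK [v2r v in LHS]row_sum_delta.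
  apply/rowP => k; rewrite !mxE !linear_sum /=; apply: eq_bigr => i _.
  by rewrite mxE !linearZ.
have fp : f2mx p = C *m E.
  apply/row_matrixP => i; rewrite !rowE mulmxA.
  rewrite -[delta_mx 0 i]r2vK -v2r_lfun -rC.
  rewrite [in LHS](coord_vbasis (pU _)) linear_sum /= mulmx_sum_row.
  by apply: eq_bigr => k _; rewrite linearZ /= mxE rowK.
rewrite lftraceC /lftrace f2mx_comp fp -mulmxA mxtrace_mulC; congr (\tr _).
apply/row_matrixP => j; rewrite !row_mul rowK -v2r_lfun -rC.
by apply/rowP => k; rewrite !mxE.
Qed.
End Trace.

(** * Supertraces and homogeneous maps *)

Section SuperTrace.
Variable K : fieldType.
Implicit Types V W : superspace K.

(** f is homogeneous of degree r; for V = W this unfolds to has_degree. *)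
Definition hom_degree V W r (f : 'Hom(V, W)) : Prop :=
  forall i v, v \in part V i -> f v \in part W (r (+) i).

Lemma hom_degree_hproj V W r (f : 'Hom(V, W)) i : hom_degree r f ->
  (hproj W (r (+) i) \o f = f \o hproj V i)%VF.
Proof.
move=> df; apply/lfunP; apply: part_ind => [u v|j v vj].
  by rewrite !linearD /= => -> ->.
rewrite !comp_lfunE (hprojE _ vj) (hprojE _ (df _ _ vj)) linearZ /=.
by case: r i j {df vj} => [] [] [].
Qed.

Lemma block_traceE V i (f : 'End(V)) :
  block_trace i f = lftrace (hproj V i \o f)%VF.
Proof. by apply: lftrace_proj => v; apply: mem_hproj. Qed.

Lemma str_linear V : scalar (@str K V).
Proof.
move=> k f g; rewrite /str !block_traceE.
by rewrite !(comp_lfunDr, =^~ comp_lfunZr) !linearP /=; ring.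
Qed.

HB.instance Definition _ V :=
  GRing.isLinear.Build K 'End(V) K _ (@str K V) (@str_linear V).

(** Supercyclicity: g carries the degree i part to the degree t + i part, so
    the i-th block of f g and the (t + i)-th block of g f have the same trace.
    No homogeneity of f is required. *)
Lemma strC V W t (f : 'Hom(W, V)) (g : 'Hom(V, W)) : hom_degree t g ->
  str (f \o g)%VF = (-1) ^+ t * str (g \o f)%VF.
Proof.
move=> dg.
have C i : block_trace i (f \o g)%VF = block_trace (t (+) i) (g \o f)%VF.
  rewrite !block_traceE lftraceC -comp_lfunA -(hom_degree_hproj i dg).
  by rewrite lftraceC comp_lfunA.
by rewrite /str !C; case: t {dg C} => /=; ring.
Qed.

Lemma str_odd V (f : 'End(V)) : has_degree true f -> str f = 0.
Proof.
move=> df; suff h i : block_trace i f = 0 by rewrite /str !h subrr.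
have hK : (hproj V i \o hproj V i = hproj V i)%VF.
  by apply/lfunP => v; rewrite comp_lfunE hproj_id ?mem_hproj.
rewrite block_traceE -hK -comp_lfunA lftraceC -comp_lfunA.
rewrite -(hom_degree_hproj i df) comp_lfunA.
have -> : (hproj V i \o hproj V (~~ i) = 0)%VF.
  apply/lfunP => v; rewrite comp_lfunE (hprojE _ (mem_hproj _ _)) zero_lfunE.
  by case: (i); rewrite scale0r.
by rewrite comp_lfun0l linear0.
Qed.
End SuperTrace.

(** * The Killing form on L(B) compressed to B *)

Section KillingRicci.
Variables (K : fieldType) (B : bolSuperalgebra K).
Local Notation L := (stdL B).
Implicit Types (x y z : B) (u v : L) (i j k r : bool).

Lemma inB_linear : linear (@inB K B : B -> L).
Proof. by move=> k x y; congr (_, _); rewrite /= scaler0 addr0. Qed.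

HB.instance Definition _ :=
  GRing.isLinear.Build K B L _ (@inB K B) inB_linear.

(** The inclusion of B in L(B), the projection of L(B) onto B along IPS(B,B),
    and the projection of L(B) onto IPS(B,B) along B. *)
Definition incB : 'Hom(B, L) := linfun (@inB K B).
Definition prB : 'Hom(L, B) := linfun (fst : L -> B).
Definition prIPS : 'End(L) := \1%VF - (incB \o prB)%VF.

Lemma incBE x : incB x = inB x. Proof. exact: lfunE. Qed.
Lemma prBE u : prB u = u.1. Proof. exact: lfunE. Qed.

Lemma adE u v : ad u v = bracket u v. Proof. exact: lfunE. Qed.

Lemma prIPSE u : prIPS u = (0, u.2).
Proof.
rewrite add_lfunE opp_lfunE id_lfunE comp_lfunE prBE incBE.
by case: u => x p; congr (_, _) => /=; rewrite ?subrr ?subr0.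
Qed.

Lemma prB_degree : hom_degree false prB.
Proof. by move=> r [x p] /L_partP[xr _]; rewrite prBE. Qed.

(** ad y maps IPS(B,B) into B, by the bracket of B with IPS(B,B). *)
Lemma ad_prIPS j r y u : y \in part B j -> u \in part L r ->
  ad (inB y) (prIPS u) = inB (- ((-1) ^+ (r && j) *: (vsval u.2).1 y)).
Proof.
case: u => x p yj /L_partP[_ pr]; rewrite prIPSE adE /=.
case def_p: (vsval p) pr => [P a] pr /=.
rewrite -(bracket_BI pr yj); congr (bracket _ (_, _)).
by apply: val_inj; apply: etrans def_p (esym (inIPSK pr)).
Qed.

Lemma ad_prIPS_degree j y : y \in part B j ->
  hom_degree j (prB \o ad (inB y) \o prIPS)%VF.
Proof.
move=> yj r u ur; rewrite !comp_lfunE (ad_prIPS yj ur) prBE /=.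
case: u ur => x p /L_partP[_]; case: (vsval p) => P a /IPS_partP[_ [dP _ _ _]].
by rewrite memvN memvZ // addbC dP.
Qed.

Lemma ad_prIPS_incB j y : y \in part B j ->
  (ad (inB y) \o prIPS = incB \o (prB \o ad (inB y) \o prIPS))%VF.
Proof.
move=> yj; apply/lfunP; apply: part_ind => [u v|r u ur].
  by rewrite !linearD /= => -> ->.
by rewrite !comp_lfunE (ad_prIPS yj ur) prBE incBE.
Qed.

(** ad x maps B into IPS(B,B). *)
Lemma prIPS_ad_incB i x : x \in part B i ->
  (prIPS \o (ad (inB x) \o incB) = ad (inB x) \o incB)%VF.
Proof.
move=> xi; apply/lfunP; apply: part_ind => [u v|k z zk].
  by rewrite !linearD /= => -> ->.
by rewrite !comp_lfunE incBE adE (bracket_BB xi zk) prIPSE.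
Qed.

(** The compression to B of ad x o ad y, i.e. the map sending z to the B
    component of [x, [y, z]]. *)
Definition adB x y : 'End(B) := (prB \o ad (inB x) \o ad (inB y) \o incB)%VF.

Lemma killing_ricciE i j x y : x \in part B i -> y \in part B j ->
  killing_ricci x y = str (adB x y) + (-1) ^+ j * str (adB y x).
Proof.
move=> xi yj; rewrite /killing_ricci /killing.
set a := ad (inB x); set b := ad (inB y).
have -> : (a \o b)%VF = ((a \o b \o incB) \o prB)%VF
                     + ((a \o incB) \o (prB \o b \o prIPS))%VF.
  rewrite -[LHS]comp_lfun1r -[\1%VF](subrK (incB \o prB)%VF) addrC comp_lfunDr.
  congr (_ + _); first by rewrite comp_lfunA.
  by rewrite -[RHS]comp_lfunA -(ad_prIPS_incB yj) comp_lfunA.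
rewrite linearD /= (strC _ prB_degree) mul1r (strC _ (ad_prIPS_degree yj)).
by rewrite !comp_lfunA /adB -![in RHS]comp_lfunA -(prIPS_ad_incB xi) !comp_lfunA.
Qed.

Lemma adB_E i j x y : x \in part B i -> y \in part B j ->
  adB x y = (-1) ^+ (i && j) *: ricci_end y x.
Proof.
move=> xi yj; apply/lfunP; apply: part_ind => [u v|k z zk].
  by rewrite !linearD /= => -> ->.
rewrite scale_lfunE (ricci_endE yj xi zk) !comp_lfunE incBE.
rewrite !adE (bracket_BB yj zk) (bracket_BI (IPS_btri yj zk) xi) prBE /= (bs2 yj zk xi).
rewrite !scalerN opprK !scalerA.
by congr (_ *: _); case: i j k {xi yj zk} => [] [] [] /=; ring.
Qed.

Lemma ricci_end_degree i j x y : x \in part B i -> y \in part B j ->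
  has_degree (i (+) j) (ricci_end x y).
Proof.
move=> xi yj k z zk; rewrite (ricci_endE xi yj zk) memvZ //.
by rewrite addbC addbA btri_part.
Qed.
End KillingRicci.

Theorem theorem4p2 (K : fieldType) (charK0 : [pchar K] =i pred0)
    (B : bolSuperalgebra K) (i j : bool) (x y : B)
    (xi : x \in part B i) (yj : y \in part B j) :
  killing_ricci x y = str (ricci_end x y + (-1) ^+ (i && j) *: ricci_end y x).
Proof.
rewrite (killing_ricciE xi yj) (adB_E xi yj) (adB_E yj xi) !linearD !linearZ /=.
have := @str_odd _ _ (ricci_end x y); have := ricci_end_degree xi yj.
by case: i j {xi yj} => [] [] /= dR sR; [ring | rewrite sR //; ring .. | ring].
Qed.
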